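(* Let $q$ be a prime power, $t$ a positive integer, $k>1$ an integer, $\ell>2$ an integer with $\ell\mid q^t-1$, and let $\varepsilon\in\mathbb{F}_{q^t}$ be such that $\{1,\varepsilon,\ldots,\varepsilon^{\ell-1}\}$ is the set of all roots of $X^\ell-1$. Put $E_j=\{x\in\mathbb{F}_{q^{\ell t}}\colon x^{q^t}=\varepsilon^jx\}$, $j=0,\ldots,\ell-1$. Assume that $s$ and $\tilde s$ are integers coprime with $t$, $1\le s<t$, $1\le\tilde s<t$, and $\eta,\tilde\eta\in E_1\setminus\{0\}$. Let $I,\tilde I$ be $\mathbb{F}_q$-subspaces of $\mathbb{F}_{q^t}$ with $\dim_{\mathbb{F}_q}I>2$. Then the following properties hold: (i) If $s\neq\tilde s,\ t-\tilde s$, and $I=\mathbb{F}_{q^t}$, then $(T_{s,\eta,I})^k$ and $(T_{\tilde s,\tilde\eta,\tilde I})^k$ belong to distinct orbits under the action of $\Gamma\mathrm{L}(k,q^{\ell t})$. (ii) The $\mathbb{F}_q$-subspaces $(T_{s,\eta,I})^k$ and $(T_{s,\tilde\eta,\tilde I})^k$ are equivalent under $\Gamma\mathrm{L}(k,q^{\ell t})$ if, and only if, there is an automorphism $\iota$ of $\mathbb{F}_{q^{\ell t}}$ such that $E_1^\iota=E_1$, $\mathrm{N}_{q^t/q}(\eta^\iota\tilde\eta^{-1})=1$, and $\tilde I=\Theta I^\iota$ for some $\Theta\in\mathbb{F}_{q^t}$ with $\Theta^{q^s-1}=\eta^\iota\tilde\eta^{-1}$. (iii) The $\mathbb{F}_q$-subspaces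 $(T_{s,\eta,I})^k$ and $(T_{t-s,\tilde\eta,\tilde I})^k$ are equivalent under $\Gamma\mathrm{L}(k,q^{\ell t})$ if, and only if, there is an automorphism $\iota$ of $\mathbb{F}_{q^{\ell t}}$ such that $E_1^\iota=E_{\ell-1}$ and $\tilde I=\Lambda\eta^\iota(I^\iota)^{q^s}$ for some $\Lambda\in E_1$ with $\Lambda^{1-q^{t-s}}=\tilde\eta(\eta^\iota)^{q^{t-s}}$.
   Context: For $s$ a positive integer, $\eta\in E_1\setminus\{0\}$ and $I$ an $\mathbb{F}_q$-subspace of $\mathbb{F}_{q^t}$, $T_{s,\eta,I}=\{x+\eta x^{q^s}\colon x\in I\}\subseteq\mathbb{F}_{q^{\ell t}}$, and $(T_{s,\eta,I})^k\subseteq\mathbb{F}_{q^{\ell t}}^k$ is its $k$-fold Cartesian power. $\mathrm{N}_{q^t/q}(x)=x^{(q^t-1)/(q-1)}$ for $x\in\mathbb{F}_{q^t}$. $\Gamma\mathrm{L}(k,q^{\ell t})$ is the group of invertible semilinear maps $v\mapsto A v^\iota$ of $\mathbb{F}_{q^{\ell t}}^k$ ($A\in\mathrm{GL}(k,q^{\ell t})$, $\iota$ a field automorphism of $\mathbb{F}_{q^{\ell t}}$ applied coordinatewise); $x^\iota$ is the image of $x$ under $\iota$, for a set $S$ one writes $S^\iota=\{x^\iota\colon x\in S\}$, and $(I^\iota)^{q^s}=\{y^{q^s}\colon y\in I^\iota\}$. *)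

(* Defs.v *)
From HB Require Import structures.
From mathcomp Require Import all_boot all_order all_algebra all_field.
From mathcomp Require Import classical_sets.
Set Implicit Arguments.
Unset Strict Implicit.
Unset Printing Implicit Defensive.
Import GRing.Theory.
Local Open Scope classical_set_scope.
Local Open Scope ring_scope.

(* F_q is a finite field F with #|F| = q, F_{q^(l t)} is a field extension L of
   F of degree l * t, and F_{q^t} is the subfield K of L of degree t over F.
   The definitions below are over an arbitrary field L, with q and t explicit. *)

Section Definitions.
Variable L : fieldType.
Implicit Types (q t s j k : nat) (I : set L).

Definition Eset q t (eps : L) j : set L :=
  [set x : L | x ^+ (q ^ t) = eps ^+ j * x].

Definition Tset q s (eta : L) I : set L :=
  [set x + eta * x ^+ (q ^ s) | x in I].

Definition cartpow k (S : set L) : set 'cV[L]_k :=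
  [set v : 'cV[L]_k | forall i, S (v i ord0)].

Definition relnorm q t (x : L) : L := x ^+ ((q ^ t - 1) %/ (q - 1))%N.

(* Field automorphisms are ring automorphisms of L; they are not required to
   fix F_q. *)
Definition GammaL k : set ('cV[L]_k -> 'cV[L]_k) :=
  [set phi | exists A : 'M[L]_k, exists iota : {rmorphism L -> L},
     [/\ A \in unitmx, bijective iota & phi = fun v => A *m map_mx iota v]].

Definition GammaL_equiv k (X Y : set 'cV[L]_k) : Prop :=
  exists2 phi, @GammaL k phi & phi @` X = Y.

End Definitions.

Arguments cartpow {L} k S.
Arguments GammaL L k : clear implicits.
Arguments GammaL_equiv {L k} X Y.

(* Main.v *)
Require Import Defs.
From HB Require Import structures.
From mathcomp Require Import all_boot all_order all_algebra all_field.
From mathcomp Require Import classical_sets.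
Set Implicit Arguments.
Unset Strict Implicit.
Unset Printing Implicit Defensive.
Import GRing.Theory.
Local Open Scope classical_set_scope.
Local Open Scope ring_scope.
From mathcomp Require Import ring zify.

(**
Write Q for q^t, phi for the map x |-> x^Q, and E_1 for the eps-eigenspace of
phi; its 1-eigenspace is K.

Reduction to a scalar.  A nonzero entry of the matrix of a semilinear
equivalence gives a scalar a with a T^iota inside T', and a nonzero entry of
the inverse matrix gives an inclusion in the other direction.  The product of
the two scalars has finite multiplicative order, so the first inclusion is
already an equality.  Hence the Cartesian powers of T and T' are equivalent if
and only if T' = a T^iota for some nonzero a and some automorphism iota
([GammaL_equiv_cartpowP]).

The eigenvalue of the scalar.  Put b = eta^iota and zeta = eps^iota.  For every
x in I^iota the vector a x + a b x^(q^s) lies in K + E_1, so it is killed by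
(phi - 1)(phi - eps).  Since x lies in K, that operator acts on the coefficients
a and a b only, and since x and x^(q^s) are linearly independent functions on
I^iota both coefficients are killed.  These two linear conditions on a, phi a
and phi^2 a force a to be an eigenvector of phi with eigenvalue 1 or eps, and
then zeta = eps or zeta = eps^-1 respectively ([frob_scalar_cases]).

Comparing the components in K and in E_1 of a x + a b x^(q^s) =
y + eta' y^(q^s') then gives y as a function of x and one more identity
between powers of x ([scaled_Tset_cases]):
- if a lies in K, then y = a x, and x^(q^s') is proportional to x^(q^s);
- if a lies in E_1, then y = a b x^(q^s), and x^(q^(s + s')) is proportional
  to x.

Bounding the dimension.  If x^(q^m) is proportional to x^(q^n) on I^iota, then
the ratios of elements of I are fixed by the Frobenius powers of exponents
m - n and t, hence by that of exponent d = gcd(m - n, t), so that dim I <= d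
([dim_frob_proportional]).  This gives the linear independence used above
because s is coprime with t.  For I = K it forces s' = s or s + s' = t.  For
dim I > 2 it excludes the second alternative when s' = s and the first when
s' = t - s, because in both situations d divides both t and 2 s.  What remains
is (ii) with Theta = a and (iii) with Lambda = a.  The converses follow from
the same component identities, with a = Theta or a = Lambda.
*)

(** * Frobenius powers on subspaces of a finite field *)

Section FrobeniusPowers.
Variables (F : finFieldType) (L : fieldExtType F).
Implicit Types (x y : L) (m n t : nat) (K : {subfield L}) (I : {vspace L}).
Local Notation q := #|F|.

Lemma frobD x y n : (x + y) ^+ (q ^ n) = x ^+ (q ^ n) + y ^+ (q ^ n).
Proof.
have [p p_pr pcharFp] := finPcharP F.
have pcharLp : p \in [pchar L] by rewrite (pchar_lalg L).
apply: exprDn_pchar; rewrite (eq_pnat _ (pcharf_eq pcharLp)) pnatX.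
by rewrite [#|F|](card_pprimeChar pcharFp) pnatX pnat_id.
Qed.

Lemma frobB x y n : (x - y) ^+ (q ^ n) = x ^+ (q ^ n) - y ^+ (q ^ n).
Proof. by apply/eqP; rewrite eq_sym subr_eq -frobD subrK. Qed.

Lemma frob_inj n : injective (fun x => x ^+ (q ^ n)).
Proof.
move=> x y /eqP; rewrite -subr_eq0 -frobB expf_eq0 subr_eq0.
by case/andP=> _ /eqP.
Qed.

Lemma expr_frob x m n : (x ^+ (q ^ m)) ^+ (q ^ n) = x ^+ (q ^ (m + n)).
Proof. by rewrite -exprM expnD. Qed.

Lemma mem_frob K x : (x \in K) = (x ^+ (q ^ \dim K) == x).
Proof. exact: Fermat's_little_theorem. Qed.

Lemma expf_subfield_pred K x : x \in K -> x != 0 -> x ^+ (q ^ \dim K).-1 = 1.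
Proof.
move=> Kx x0; apply: (mulfI x0); rewrite -exprS mulr1.
rewrite prednK; first by apply/eqP; rewrite -mem_frob.
by rewrite expn_gt0 ltnW // finNzRing_gt1.
Qed.

(** A subspace of dimension n has q^n elements, all of them roots of p. *)
Lemma expn_dim_lt_size I (p : {poly L}) :
  p != 0 -> {in I, forall x, root p x} -> (q ^ \dim I < size p)%N.
Proof.
move=> p0 pI; pose I' : {vspace finvect_type L} := I.
rewrite -[X in (X < _)%N](card_vspace I') cardE.
apply: (@max_poly_roots L p (enum I') p0 _ (enum_uniq _)).
apply/allP=> x Ix; apply: pI.
by rewrite (mem_enum I' x) in Ix.
Qed.

(** The exponents of the Frobenius powers that fix x are closed under addition
    and under cancellation, so Bezout's identity applies. *)
Lemma frob_fix_gcd x m t : (0 < t)%N ->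
  x ^+ (q ^ m) = x -> x ^+ (q ^ t) = x -> x ^+ (q ^ gcdn m t) = x.
Proof.
move=> t0 xm xt.
have frob_fix_mul k n : x ^+ (q ^ n) = x -> x ^+ (q ^ (k * n)) = x.
  by move=> xn; elim: k => // k IHk; rewrite mulSn -expr_frob xn.
have [a _ /dvdnP[b eab]] := Bezoutl m t0.
have := frob_fix_mul b t xt; rewrite -eab addnC -expr_frob gcdnC.
by rewrite frob_fix_mul.
Qed.

(** Dividing by a fixed nonzero z0 in I cancels the constants, and the
    automorphism iota together with them: z / z0 is fixed by the Frobenius
    powers of exponents m - n (if n <= m) and dim K, hence is a root of
    X^(q^d) - X for their gcd d, a polynomial with at most q^d roots.  A
    congruence is stated because it is symmetric in m and n. *)
Lemma dim_frob_proportional K I (iota : {rmorphism L -> L}) m n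
    (alpha beta : L) :
    (I <= K)%VS -> alpha != 0 ->
    {in I, forall z, alpha * iota z ^+ (q ^ m) = beta * iota z ^+ (q ^ n)} ->
  exists d, [/\ (\dim I <= d)%N, (d %| \dim K)%N & m = n %[mod d]].
Proof.
move=> sIK alpha0 propI.
have [I0 | [z0 Iz0 nz0]] : I = 0%VS \/ exists2 z0, z0 \in I & z0 != 0.
- have [-> | nI] := eqVneq I 0%VS; [by left | right].
  by exists (vpick I); rewrite ?memv_pick ?vpick0.
- by exists 1%N; rewrite I0 dimv0 dvd1n !modn1.
have iz0 j : iota z0 ^+ (q ^ j) != 0 by rewrite expf_neq0 // fmorph_eq0.
have beta0 : beta != 0.
  apply/eqP=> b0; have /eqP := propI _ Iz0.
  by rewrite b0 mul0r mulf_eq0 (negPf alpha0) (negPf (iz0 m)).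
wlog le_nm : m n alpha beta alpha0 beta0 propI / (n <= m)%N.
  move=> IH; have [|/ltnW] := leqP n m; first exact: IH propI.
  case/(IH _ _ beta alpha) => // [z /propI-> // | d [? ? e]].
  by exists d; rewrite e.
exists (gcdn (m - n) (\dim K)); split; last 2 first.
- exact: dvdn_gcdr.
- by apply/eqP; rewrite eqn_mod_dvd // dvdn_gcdl.
set d := gcdn _ _.
have q1 : (1 < q)%N := finNzRing_gt1 F.
have K0 : (0 < \dim K)%N by rewrite adim_gt0.
have d0 : (0 < d)%N by rewrite gcdn_gt0 K0 orbT.
have cross_mul (a b c e : L) :
    alpha * a = beta * b -> alpha * c = beta * e -> a * e = b * c.
  move=> e1 e2; apply: (mulfI alpha0); apply: (mulfI beta0).
  transitivity ((alpha * a) * (beta * e)); first by ring.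
  by rewrite e1 -e2; ring.
have fixd z : z \in I -> (z / z0) ^+ (q ^ d) = z / z0.
  move=> Iz; apply: frob_fix_gcd => //; last first.
    by apply/eqP; rewrite -mem_frob rpredM ?rpredV ?(subvP sIK).
  apply: (fmorph_inj iota); apply: (@frob_inj n).
  rewrite rmorphXn /= expr_frob subnK // fmorph_div /= !expr_div_n.
  apply/eqP; rewrite eqr_div ?iz0 //; apply/eqP.
  exact: cross_mul (propI _ Iz) (propI _ Iz0).
rewrite -(leq_exp2l _ _ q1).
pose p : {poly L} := 'X^(q ^ d) - (z0 ^+ (q ^ d) / z0) *: 'X.
have szp : size p = (q ^ d).+1.
  rewrite /p size_polyDl ?size_polyXn // size_polyN.
  apply: leq_ltn_trans (size_scale_leq _ _) _.
  by rewrite size_polyX ltnS -[X in (X < _)%N](expn0 q) ltn_exp2l.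
rewrite -ltnS -szp; apply: expn_dim_lt_size.
  by rewrite -size_poly_eq0 szp.
move=> z Iz; rewrite /root /p hornerD hornerN hornerZ hornerX hornerXn.
rewrite -[X in X ^+ _](divfK nz0) exprMn fixd // subr_eq0; apply/eqP.
by rewrite mulrAC [RHS]mulrAC [z * _]mulrC.
Qed.

End FrobeniusPowers.

(** * Semilinear equivalence of Cartesian powers *)

Section SemilinearEquivalence.
Variables (F : finFieldType) (L : fieldExtType F).
Implicit Types (S : set L) (rho : {rmorphism L -> L}).

Lemma unitmx_entry_neq0 (R : fieldType) k (A : 'M[R]_k) :
  (0 < k)%N -> A \in unitmx -> exists i j, A i j != 0.
Proof.
case: k A => // k A _ Au; have /matrix0Pn // : A != 0.
by apply: contraTneq Au => ->; rewrite unitmxE det0 unitr0.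
Qed.

(** Entries of A and of its inverse give a and c with a S^rho inside S' and
    c S' inside S^rho.  Thus S' is stable under a c, which has finite order, and
    y = a (c (a c)^(n - 1) y) for y in S' and a c of order n. *)
Lemma GammaL_equiv_cartpowP k S S' : (0 < k)%N -> S 0 -> S' 0 ->
  GammaL_equiv (cartpow k S) (cartpow k S') <->
  exists a rho, [/\ a != 0, bijective rho & S' = [set a * y | y in rho @` S]].
Proof.
move=> k0 S0 S'0; split.
  case=> _ [A [rho [Au bij_rho ->]]] eqX.
  pose single (j : 'I_k) (x : L) : 'cV[L]_k := x *: delta_mx j ord0.
  have singleP T j x : T 0 -> T x -> cartpow k T (single j x).
    move=> T0 Tx i; rewrite !mxE andbT.
    by case: eqP => _; rewrite ?mulr1 ?mulr0.
  have mul_single (B : 'M[L]_k) i j x : (B *m single j x) i ord0 = B i j * x.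
    by rewrite -scalemxAr -colE !mxE mulrC.
  have map_single j x : map_mx rho (single j x) = single j (rho x).
    by rewrite map_mxZ map_delta_mx.
  have [i [j nzA]] := unitmx_entry_neq0 k0 Au.
  have Bu : invmx A \in unitmx by rewrite unitmx_inv.
  have [i' [j' nzB]] := unitmx_entry_neq0 k0 Bu.
  have SA x : S x -> S' (A i j * rho x).
    move=> Sx; have := singleP S j x S0 Sx.
    move/(imageP (fun v => A *m map_mx rho v)).
    by rewrite eqX => /(_ i); rewrite map_single mul_single.
  have SB y : S' y -> exists2 x, S x & rho x = invmx A i' j' * y.
    move=> Sy; have := singleP S' j' y S'0 Sy; rewrite -eqX => -[v Sv eqv].
    exists (v i' ord0) => //.
    by rewrite -mul_single -eqv mulKmx // mxE.
  set a := A i j in nzA SA; set c := invmx A i' j' in nzB SB.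
  have nzac : a * c != 0 by rewrite mulf_neq0.
  have S'ac n y : S' y -> S' ((a * c) ^+ n * y).
    elim: n y => [|n IHn] y Sy; first by rewrite mul1r.
    rewrite exprSr -mulrA; apply: IHn; rewrite -mulrA.
    by have [x /SA Sx <-] := SB _ Sy.
  exists a, rho; split => //; apply/seteqP; split => y; last first.
    by case=> _ [x Sx <-] <-; apply: SA.
  move=> S'y; set N := (#|F| ^ \dim {:L}%AS)%N.
  have N2 : (1 < N)%N.
    by rewrite -[X in (X < _)%N](expn0 #|F|) ltn_exp2l ?finNzRing_gt1 ?adim_gt0.
  (* y = (a c)^(N - 1) y = a (c ((a c)^(N - 2) y)) *)
  have [x Sx eqx] := SB _ (S'ac N.-2 y S'y).
  exists (rho x); first by exists x.
  rewrite eqx !mulrA -exprS -[N.-2.+1]/(N.-2.+2.-1).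
  have -> : N.-2.+2 = N by case: (N) N2 => [|[]].
  by rewrite (@expf_subfield_pred F L {:L}%AS) ?mul1r ?memvf.
case=> a [rho [a0 bij_rho eqS]]; have [g gK Kg] := bij_rho.
exists (fun v => a%:M *m map_mx rho v).
  by exists a%:M, rho; split; rewrite // unitmxE det_scalar unitfE expf_neq0.
apply/seteqP; split => [_ [v Sv <-] i | w S'w].
  rewrite mul_scalar_mx !mxE eqS; exists (rho (v i ord0)) => //.
  by exists (v i ord0).
exists (map_mx (fun y => g (a^-1 * y)) w).
  move=> i; rewrite mxE; have := S'w i; rewrite eqS => -[_ [x Sx <-] <-].
  by rewrite mulKf // gK.
by apply/matrixP => i j; rewrite mul_scalar_mx !mxE Kg mulVKf.
Qed.

End SemilinearEquivalence.

(** * The eigenvalue of the scalar *)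

(** In this section a1 and a2 stand for the images of a under phi and phi^2, and
    e and z for eps and its image zeta under the automorphism. *)
Section EigenvalueAlgebra.
Variable R : fieldType.
Implicit Types a e z : R.

(** Apply (phi - 1)(phi - e) = phi^2 - (1 + e) phi + e to the first equation;
    its images under phi and phi^2 are the other two. *)
Lemma frob_combination (X Xs b y ys c a a1 a2 e z : R) :
    a * (X + b * Xs) = y + c * ys ->
    a1 * (X + z * b * Xs) = y + e * c * ys ->
    a2 * (X + z * (z * b) * Xs) = y + e * (e * c) * ys ->
  (a2 - (1 + e) * a1 + e * a) * X +
  (z ^+ 2 * a2 - (1 + e) * z * a1 + e * a) * b * Xs = 0.
Proof.
move=> W0 W1 W2.
transitivity (a2 * (X + z * (z * b) * Xs) - (1 + e) * (a1 * (X + z * b * Xs))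
  + e * (a * (X + b * Xs))); first by ring.
by rewrite W0 W1 W2; ring.
Qed.

(** Eliminating a2 leaves a multiple of 1 - z. *)
Lemma eigen_ratio e z a a1 a2 : z != 1 ->
    a2 - (1 + e) * a1 + e * a = 0 ->
    z ^+ 2 * a2 - (1 + e) * z * a1 + e * a = 0 ->
  (1 + e) * z * a1 = e * (z + 1) * a.
Proof.
rewrite eq_sym -subr_eq0 => z1 D1 D2; apply/eqP; rewrite -subr_eq0; apply/eqP.
apply: (mulfI z1); rewrite mulr0.
transitivity (z ^+ 2 * (a2 - (1 + e) * a1 + e * a) -
  (z ^+ 2 * a2 - (1 + e) * z * a1 + e * a)); first by ring.
by rewrite D1 D2; ring.
Qed.

(** If (1 + e) z is nonzero, the first two equations say that a1 = r a and
    a2 = r a1 with r = e (z + 1) / ((1 + e) z), and the third that r is a root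
    of (X - 1)(X - e); here r = 1 amounts to e = z, and r = e to e z = 1.
    Clearing denominators gives an argument without division. *)
Lemma eigen_values e z a a1 a2 : e != 0 -> a != 0 ->
    (1 + e) * z * a1 = e * (z + 1) * a ->
    (1 + e) * z * a2 = e * (z + 1) * a1 ->
    a2 - (1 + e) * a1 + e * a = 0 ->
  e = z \/ e * z = 1.
Proof.
move=> e0 a0 e1 e2 D1.
have : e * a * ((e - z) * (1 - e * z)) = 0.
  set u := (1 + e) * z in e1 e2; set v := e * (z + 1) in e1 e2.
  transitivity (v * (v * a) - (1 + e) * (u * (v * a)) + e * u ^+ 2 * a).
    by rewrite /u /v; ring.
  rewrite -e1.
  transitivity
    (u * (v * a1) - (1 + e) * (u * (u * a1)) + e * u ^+ 2 * a); first by ring.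
  rewrite -e2.
  transitivity (u ^+ 2 * (a2 - (1 + e) * a1 + e * a)); first by ring.
  by rewrite D1 mulr0.
move/eqP; rewrite mulf_eq0 mulf_eq0 (negPf e0) (negPf a0) /= mulf_eq0 !subr_eq0.
by case/orP=> /eqP; [left | right].
Qed.

End EigenvalueAlgebra.

Section Eigenspaces.
Variables (F : finFieldType) (L : fieldExtType F) (K : {subfield L}) (eps : L).
Local Notation q := #|F|.
Local Notation t := (\dim K).
Local Notation E1 := (Eset q t eps 1).
Hypotheses (epsK : eps \in K) (eps0 : eps != 0).
Hypotheses (eps1 : eps != 1) (eps2 : eps ^+ 2 != 1).

Lemma frobK x : x \in K -> x ^+ (q ^ t) = x.
Proof. by rewrite mem_frob => /eqP. Qed.

Lemma rmorph_subfield (iota : {rmorphism L -> L}) x : x \in K -> iota x \in K.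
Proof. by rewrite !mem_frob -rmorphXn => /eqP ->. Qed.

Lemma Eset1_mulK x y : E1 x -> y \in K -> E1 (x * y).
Proof. by move=> Ex Ky; rewrite /Eset /= exprMn Ex frobK ?mulrA. Qed.

(** K and E_1 are eigenspaces of x |-> x^(q^t) for distinct eigenvalues, so
    their sum is direct. *)
Lemma subfield_Eset1_uniq x0 y0 x1 y1 :
    x0 \in K -> y0 \in K -> E1 x1 -> E1 y1 -> x0 + x1 = y0 + y1 ->
  x0 = y0 /\ x1 = y1.
Proof.
move=> Kx Ky Ex Ey eqxy; have d01 : x0 - y0 = y1 - x1.
  by apply/eqP; rewrite subr_eq addrAC eq_sym subr_eq addrC eqxy addrC.
have Kd : y1 - x1 \in K by rewrite -d01 rpredB.
have : (1 - eps) * (y1 - x1) = 0.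
  rewrite mulrBl mul1r -{1}(frobK Kd) frobB Ex Ey expr1; ring.
move/eqP; rewrite mulf_eq0 subr_eq0 eq_sym (negPf eps1) /= => /eqP d0.
by split; apply/eqP; [rewrite -subr_eq0 d01 | rewrite eq_sym -subr_eq0];
  apply/eqP.
Qed.

Section ScaledSubspaces.
Variables (s s' : nat) (a eta eta' : L) (I I' : {vspace L}).
Variable iota : {rmorphism L -> L}.
Hypotheses (cop_st : coprime s t) (a0 : a != 0).
Hypotheses (Eeta : E1 eta) (eta0 : eta != 0) (Eeta' : E1 eta').
Hypotheses (sIK : (I <= K)%VS) (sI'K : (I' <= K)%VS) (dimI : (1 < \dim I)%N).

(** A nontrivial relation would make z^(q^s) proportional to z on I, which
    bounds the dimension of I by gcd(s, t) = 1. *)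
Lemma frob_lin_indep alpha beta :
    {in I, forall z, alpha * iota z + beta * iota z ^+ (q ^ s) = 0} ->
  alpha = 0 /\ beta = 0.
Proof.
move=> h; have b0 : beta = 0.
  apply/eqP; apply: contraLR dimI => b0.
  have [z Iz | d [le_d d_t /eqP]] := dim_frob_proportional (m := s) (n := 0)
    (beta := - alpha) (iota := iota) sIK b0.
    by apply/eqP; rewrite mulNr expn0 expr1 -addr_eq0 addrC h.
  rewrite mod0n -/(d %| s)%N => d_s; rewrite -leqNgt (leq_trans le_d) //.
  by rewrite dvdn_leq // -(eqP cop_st) dvdn_gcd d_t d_s.
split=> //; have Ip : vpick I \in I := memv_pick I.
have := h _ Ip; rewrite b0 mul0r addr0 => /eqP.
rewrite mulf_eq0 fmorph_eq0 vpick0.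
by case/orP=> /eqP // I0; move: dimI; rewrite I0 dimv0.
Qed.

Hypothesis subT : {in I, forall z, exists2 y, y \in I' &
  a * iota (z + eta * z ^+ (q ^ s)) = y + eta' * y ^+ (q ^ s')}.

(** The two alternatives are the eigenvalues 1 and eps of a under
    x |-> x^(q^t). *)
Lemma frob_scalar_cases :
  (iota eps = eps /\ a \in K) \/ (iota eps * eps = 1 /\ E1 a).
Proof.
set zeta := iota eps.
have Kzeta : zeta ^+ (q ^ t) = zeta by rewrite -rmorphXn /= frobK.
have zeta1 : zeta != 1 by rewrite fmorph_eq1.
have zeta0 : zeta != 0 by rewrite fmorph_eq0.
have Eb : iota eta ^+ (q ^ t) = zeta * iota eta.
  by rewrite -rmorphXn /= Eeta rmorphM.
set b := iota eta in Eb; have b0 : b != 0 by rewrite fmorph_eq0.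
set a1 := a ^+ (q ^ t); set a2 := a1 ^+ (q ^ t).
have [D1 D2] : a2 - (1 + eps) * a1 + eps * a = 0 /\
    (zeta ^+ 2 * a2 - (1 + eps) * zeta * a1 + eps * a) * b = 0.
  apply: frob_lin_indep => z Iz; have [y I'y] := subT Iz.
  have KX : (iota z) ^+ (q ^ t) = iota z.
    by apply: frobK; apply: rmorph_subfield; apply: (subvP sIK).
  have Ky : y ^+ (q ^ t) = y by apply: frobK; apply: (subvP sI'K).
  have KXs : (iota z ^+ (q ^ s)) ^+ (q ^ t) = iota z ^+ (q ^ s).
    by rewrite exprAC KX.
  have Kys : (y ^+ (q ^ s')) ^+ (q ^ t) = y ^+ (q ^ s') by rewrite exprAC Ky.
  rewrite rmorphD rmorphM rmorphXn /= -/b => W0.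
  have W1 := congr1 (fun x => x ^+ (q ^ t)) W0.
  rewrite /= exprMn !frobD !exprMn KX Ky KXs Kys Eb Eeta' -/a1 expr1 in W1.
  have W2 := congr1 (fun x => x ^+ (q ^ t)) W1.
  rewrite /= exprMn !frobD !exprMn KX Ky KXs Kys Eb Eeta' Kzeta in W2.
  rewrite -/a2 expr1 (frobK epsK) in W2.
  exact: frob_combination W0 W1 W2.
move/eqP: D2; rewrite mulf_eq0 (negPf b0) orbF => /eqP D2.
have e1 := eigen_ratio zeta1 D1 D2.
have e2 := congr1 (fun x => x ^+ (q ^ t)) e1.
rewrite /= !exprMn !frobD !expr1n Kzeta (frobK epsK) -/a1 -/a2 in e2.
have u0 : (1 + eps) * zeta != 0.
  rewrite mulf_neq0 // addr_eq0; apply: contraNneq eps2 => e.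
  by rewrite -(opprK eps) -e sqrrN expr1n.
have [ez | ez] := eigen_values eps0 a0 e1 e2 D1.
- left; split; first by rewrite -ez.
  rewrite mem_frob -/a1; apply/eqP; apply: (mulfI u0).
  by rewrite e1 -ez; ring.
- right; split; first by rewrite mulrC.
  rewrite /Eset /= -/a1 expr1; apply: (mulfI u0); rewrite e1.
  by rewrite mulrDr mulr1 ez; ring: ez.
Qed.

End ScaledSubspaces.

(** If a lies in K, then iota eta is in E_1, so a iota(z) is the K-component and
    a iota(eta) iota(z)^(q^s) the E_1-component.  If a lies in E_1, then a and
    iota eta have inverse eigenvalues, so a iota(eta) lies in K and the two
    components are exchanged. *)
Lemma scaled_Tset_cases (s s' : nat) (a eta eta' : L) (I I' : {vspace L})
    (iota : {rmorphism L -> L}) :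
    coprime s t -> a != 0 -> E1 eta -> eta != 0 -> E1 eta' ->
    (I <= K)%VS -> (I' <= K)%VS -> (1 < \dim I)%N ->
    Tset q s' eta' [set` I'] =
      [set a * y | y in iota @` Tset q s eta [set` I]] ->
  [/\ iota eps = eps, a \in K,
      [set` I'] = [set a * y | y in iota @` [set` I]] &
      {in I, forall z, eta' * (a * iota z) ^+ (q ^ s') =
                       a * iota eta * iota z ^+ (q ^ s)}] \/
  [/\ iota eps * eps = 1, E1 a,
      [set` I'] = [set a * iota eta * y ^+ (q ^ s) | y in iota @` [set` I]] &
      {in I, forall z, eta' * (a * iota eta * iota z ^+ (q ^ s)) ^+ (q ^ s') =
                       a * iota z}].
Proof.
move=> cop a0 Eeta eta0 Eeta' sIK sI'K dimI eqT.
have expand z : a * iota (z + eta * z ^+ (q ^ s)) =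
    a * iota z + a * iota eta * iota z ^+ (q ^ s).
  by rewrite rmorphD rmorphM rmorphXn /= mulrDr mulrA.
have subT z : z \in I -> exists2 y, y \in I' &
    a * iota z + a * iota eta * iota z ^+ (q ^ s) = y + eta' * y ^+ (q ^ s').
  move=> Iz.
  have : Tset q s' eta' [set` I'] (a * iota (z + eta * z ^+ (q ^ s))).
    rewrite eqT; exists (iota (z + eta * z ^+ (q ^ s))) => //.
    by exists (z + eta * z ^+ (q ^ s)) => //; exists z.
  by case=> y Iy e; exists y; rewrite // -expand e.
have supT y : y \in I' -> exists2 z, z \in I &
    a * iota z + a * iota eta * iota z ^+ (q ^ s) = y + eta' * y ^+ (q ^ s').
  move=> Iy.
  have : Tset q s' eta' [set` I'] (y + eta' * y ^+ (q ^ s')) by exists y.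
  by rewrite eqT => -[_ [_ [z Iz <-] <-] e]; exists z; rewrite // -expand e.
have KI z : z \in I -> iota z \in K by move/(subvP sIK)/rmorph_subfield.
have KI' y : y \in I' -> y \in K := subvP sI'K y.
have E1y y : y \in I' -> E1 (eta' * y ^+ (q ^ s')).
  by move=> Iy; apply: Eset1_mulK => //; rewrite rpredX ?KI'.
have [z Iz||] := @frob_scalar_cases s s' a eta eta' I I' iota cop a0 Eeta eta0
  Eeta' sIK sI'K dimI.
- by have [y Iy e] := subT z Iz; exists y; rewrite ?expand.
- case=> eps_fix Ka; left.
  have E1b z : z \in I -> E1 (a * iota eta * iota z ^+ (q ^ s)).
    move=> Iz; rewrite mulrAC mulrC; apply: Eset1_mulK.
      by rewrite /Eset /= -rmorphXn /= Eeta rmorphM rmorphXn /= eps_fix.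
    by rewrite rpredM ?rpredX ?KI.
  have sep z y (Iz : z \in I) (Iy : y \in I') :=
    subfield_Eset1_uniq (rpredM Ka (KI z Iz)) (KI' y Iy) (E1b z Iz) (E1y y Iy).
  split=> // [|z Iz]; last first.
    by have [y Iy /(sep _ _ Iz Iy)[-> ->]] := subT z Iz.
  apply/seteqP; split => [y Iy | _ [_ [z Iz <-] <-]] /=.
    have [z Iz /(sep _ _ Iz Iy)[<- _]] := supT y Iy.
    by exists (iota z) => //; exists z.
  by have [y Iy /(sep _ _ Iz Iy)[-> _]] := subT z Iz.
- case=> eps_inv Ea; right.
  have E1a z : z \in I -> E1 (a * iota z).
    by move=> Iz; apply: Eset1_mulK (KI z Iz).
  have Kb z : z \in I -> a * iota eta * iota z ^+ (q ^ s) \in K.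
    move=> Iz; rewrite rpredM ?rpredX ?KI // mem_frob exprMn Ea.
    rewrite -rmorphXn /= Eeta.
    by rewrite rmorphM rmorphXn /= !expr1 mulrACA [eps * _]mulrC eps_inv mul1r.
  have sep z y (Iz : z \in I) (Iy : y \in I') :=
    subfield_Eset1_uniq (Kb z Iz) (KI' y Iy) (E1a z Iz) (E1y y Iy).
  split=> // [|z Iz]; last first.
    by have [y Iy] := subT z Iz; rewrite addrC => /(sep _ _ Iz Iy)[-> ->].
  apply/seteqP; split => [y Iy | _ [_ [z Iz <-] <-]] /=.
    have [z Iz] := supT y Iy; rewrite addrC => /(sep _ _ Iz Iy)[<- _].
    by exists (iota z) => //; exists z.
  by have [y Iy] := subT z Iz; rewrite addrC => /(sep _ _ Iz Iy)[-> _].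
Qed.

End Eigenspaces.

(** * Constraints on the exponents *)

Section Exponents.
Variables (F : finFieldType) (L : fieldExtType F) (K : {subfield L}).
Variables (I : {vspace L}) (iota : {rmorphism L -> L}).
Variables (s s' : nat) (a b eta' : L).
Hypotheses (sIK : (I <= K)%VS) (a0 : a != 0) (b0 : b != 0) (eta'0 : eta' != 0).
Local Notation q := #|F|.

(** The identity left by a scalar a in K, where y = a z. *)
Lemma direct_exponents :
    {in I, forall z, eta' * (a * iota z) ^+ (q ^ s') =
                     a * b * iota z ^+ (q ^ s)} ->
  exists d, [/\ (\dim I <= d)%N, (d %| \dim K)%N & s' = s %[mod d]].
Proof.
move=> h; apply: (dim_frob_proportional (iota := iota)
  (alpha := eta' * a ^+ (q ^ s')) (beta := a * b) sIK) => [|z Iz].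
  by rewrite mulf_neq0 ?expf_neq0.
by rewrite -h // exprMn mulrA.
Qed.

(** The identity left by a scalar a in E_1, where y = a b z^(q^s). *)
Lemma reversed_exponents :
    {in I, forall z, eta' * (a * b * iota z ^+ (q ^ s)) ^+ (q ^ s') =
                     a * iota z} ->
  exists d, [/\ (\dim I <= d)%N, (d %| \dim K)%N & (d %| s + s')%N].
Proof.
move=> h; have [||d [le_d d_t e]] := dim_frob_proportional (iota := iota)
  (m := s + s') (n := 0) (alpha := eta' * (a * b) ^+ (q ^ s')) (beta := a) sIK.
- by rewrite !mulf_neq0 ?expf_neq0 ?mulf_neq0.
- by move=> z Iz; rewrite -expr_frob -mulrA -exprMn h.
by exists d; rewrite /dvdn e mod0n.
Qed.

End Exponents.

Lemma dvdn_double_leq2 d s t :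
  coprime s t -> (d %| t)%N -> (d %| s + s)%N -> (d <= 2)%N.
Proof.
move=> cop d_t; rewrite addnn -muln2 Gauss_dvdr => [/dvdn_leq -> //|].
by rewrite coprime_sym; apply: coprime_dvdr cop.
Qed.

Lemma dvdn_add_small s s' t :
  (0 < s < t)%N -> (s' < t)%N -> (t %| s + s')%N -> s = (t - s')%N.
Proof. by move=> ? ? /dvdnP[[|[|c]] ec]; nia. Qed.

(** * The root of unity eps *)

Section RootsOfUnity.
Variables (F : finFieldType) (L : fieldExtType F) (K : {subfield L}) (eps : L).
Local Notation q := #|F|.
Variable l : nat.
Hypotheses (hl : (2 < l)%N) (hlq : (l %| q ^ \dim K - 1)%N).
Hypothesis heps : [set eps ^+ j | j in `I_l] =
                  [set x : L | root ('X^l - 1%:P : {poly L}) x].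

Lemma unity_root_eps x : x ^+ l = 1 -> exists j, x = eps ^+ j.
Proof.
move=> xl; have : [set x : L | root ('X^l - 1%:P : {poly L}) x] x.
  by rewrite /= /root hornerD hornerN hornerC hornerXn xl subrr.
by rewrite -heps => -[j _ <-]; exists j.
Qed.

Lemma eps_expl : eps ^+ l = 1.
Proof.
have : [set x : L | root ('X^l - 1%:P : {poly L}) x] eps.
  by rewrite -heps; exists 1%N => //=; apply: ltn_trans hl.
by rewrite /= /root hornerD hornerN hornerC hornerXn subr_eq0 => /eqP.
Qed.

(** Otherwise every l-th root of unity has square 1.  As (q^t - 1) / l powers of
    nonzero elements of K are such roots, 2 (q^t - 1) / l would be an exponent
    of the unit group of K that is smaller than its order, since l > 2. *)
Lemma eps_sqr_neq1 : eps ^+ 2 != 1.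
Proof.
apply/eqP => eps2; have [m em] := dvdnP hlq.
have q1 : (1 < q ^ \dim K)%N.
  by rewrite -[X in (X < _)%N](expn0 q) ltn_exp2l ?finNzRing_gt1 ?adim_gt0.
have m0 : (0 < m)%N by nia.
have fixK x : x \in K -> x ^+ (m * 2).+1 = x.
  move=> Kx; have [->|x0] := eqVneq x 0; first by rewrite expr0n.
  have [|j ej] := @unity_root_eps (x ^+ m).
    by rewrite -exprM -em subn1 expf_subfield_pred.
  by rewrite exprS exprM ej exprAC eps2 expr1n mulr1.
pose p : {poly L} := 'X^((m * 2).+1) - 'X.
have szp : size p = (m * 2).+2.
  by rewrite /p size_polyDl ?size_polyXn // size_polyN size_polyX; lia.
have : (q ^ \dim K < size p)%N.
  apply: expn_dim_lt_size; first by rewrite -size_poly_eq0 szp.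
  by move=> x Kx; rewrite /root /p hornerD hornerN hornerX hornerXn fixK ?subrr.
by rewrite szp; nia.
Qed.

End RootsOfUnity.

(** * Equivalences between scaled subspaces *)

Section ScaledEquivalences.
Variables (F : finFieldType) (L : fieldExtType F).
Implicit Types (I : {vspace L}) (a eta : L) (iota : {rmorphism L -> L}).

Lemma Tset0 q s eta I : (0 < q)%N -> Tset q s eta [set` I] 0.
Proof.
move=> q0; exists 0; rewrite /= ?mem0v //.
by rewrite expr0n gtn_eqF ?expn_gt0 ?q0 // mulr0 addr0.
Qed.

Lemma scaled_TsetE q s s' a eta eta' I I' iota (f : L -> L) :
    [set` I'] = f @` [set` I] ->
    {in I, forall z, a * iota (z + eta * z ^+ (q ^ s)) =
                     f z + eta' * f z ^+ (q ^ s')} ->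
  Tset q s' eta' [set` I'] = [set a * y | y in iota @` Tset q s eta [set` I]].
Proof.
move=> eqI fE; rewrite /Tset eqI !image_comp; apply: eq_imagel => z Iz /=.
by rewrite fE.
Qed.

Lemma Eset_image q t eps u iota : bijective iota -> iota eps = eps ^+ u ->
  iota @` Eset q t eps 1 = Eset q t eps u.
Proof.
case=> g gK Kg eps_u; apply/seteqP; split=> [_ [x Ex <-] | y Ey].
  by rewrite /Eset /= -rmorphXn /= Ex rmorphM /= expr1 eps_u.
exists (g y); rewrite ?Kg //; apply: (fmorph_inj iota).
by rewrite rmorphM rmorphXn /= !Kg Ey eps_u.
Qed.

(** The exponent (q^s - 1) (q^t - 1) / (q - 1) is a multiple of q^t - 1, because
    q - 1 divides q^s - 1. *)
Lemma relnorm_frob_ratio (K : {subfield L}) s x : x \in K -> x != 0 ->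
  relnorm #|F| (\dim K) (x ^+ (#|F| ^ s - 1)) = 1.
Proof.
move=> Kx x0; rewrite /relnorm -exprM.
have dvd_pred n : (#|F| - 1 %| #|F| ^ n - 1)%N.
  by rewrite !subn1 dvdn_pred_predX.
rewrite -(divnK (dvd_pred s)) -mulnA [((#|F| - 1) * _)%N]mulnC divnK //.
rewrite mulnC exprM.
by rewrite subn1 expf_subfield_pred ?expr1n.
Qed.

End ScaledEquivalences.

Theorem theorem3p11 (q t k l : nat) (F : finFieldType) (L : fieldExtType F)
    (K : {subfield L}) (eps : L) (s s' : nat) (eta eta' : L)
    (I I' : {vspace L})
    (hF : #|F| = q) (ht : (0 < t)%N) (hk : (1 < k)%N) (hl : (2 < l)%N)
    (hlq : (l %| q ^ t - 1)%N)
    (hL : \dim {:L} = (l * t)%N) (hK : \dim K = t)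
    (hepsK : eps \in K)
    (heps : [set eps ^+ j | j in `I_l] =
            [set x : L | root ('X^l - 1%:P : {poly L}) x])
    (hs : coprime s t) (hs1 : (1 <= s < t)%N)
    (hs' : coprime s' t) (hs'1 : (1 <= s' < t)%N)
    (heta : Eset q t eps 1 eta) (heta0 : eta != 0)
    (heta' : Eset q t eps 1 eta') (heta'0 : eta' != 0)
    (hI : (I <= K)%VS) (hI' : (I' <= K)%VS) (hdim : (2 < \dim I)%N) :
  [/\ (s <> s' -> s <> (t - s')%N -> I = K :> {vspace L} ->
        ~ GammaL_equiv (cartpow k (Tset q s eta [set` I]))
                       (cartpow k (Tset q s' eta' [set` I']))),
      (GammaL_equiv (cartpow k (Tset q s eta [set` I]))
                    (cartpow k (Tset q s eta' [set` I'])) <->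
        exists iota : {rmorphism L -> L},
          [/\ bijective iota,
              iota @` Eset q t eps 1 = Eset q t eps 1,
              relnorm q t (iota eta * eta'^-1) = 1 &
              exists Theta : L,
                [/\ Theta \in K,
                    Theta ^+ (q ^ s - 1)%N = iota eta * eta'^-1 &
                    [set` I'] = [set Theta * y | y in iota @` [set` I]]]]) &
      (GammaL_equiv (cartpow k (Tset q s eta [set` I]))
                    (cartpow k (Tset q (t - s)%N eta' [set` I'])) <->
        exists iota : {rmorphism L -> L},
          [/\ bijective iota,
              iota @` Eset q t eps 1 = Eset q t eps (l - 1) &
              exists Lambda : L,
                [/\ Eset q t eps 1 Lambda,
                    Lambda ^ (1 - (q ^ (t - s))%N%:Z)
                      = eta' * (iota eta) ^+ (q ^ (t - s))%N &
                    [set` I'] = [set Lambda * iota eta * y ^+ (q ^ s)%N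
                                | y in iota @` [set` I]]]])].
Proof.
subst q t.
set q := #|F|; set t := \dim K.
have q1 : (1 < q)%N := finNzRing_gt1 F.
have q0 : (0 < q)%N := ltnW q1.
have eps2 : eps ^+ 2 != 1 by apply: eps_sqr_neq1 hl hlq heps.
have epsl : eps ^+ l = 1 by apply: eps_expl hl heps.
have eps0 : eps != 0.
  apply/eqP => e; move/eqP: epsl; rewrite e expr0n gtn_eqF ?(ltn_trans _ hl) //.
  by rewrite eq_sym oner_eq0.
have eps1 : eps != 1 by apply: contraNneq eps2 => ->; rewrite expr1n.
have dimI1 : (1 < \dim I)%N := ltnW hdim.
have k0 : (0 < k)%N := ltnW hk.
have equivP s1 :=
  GammaL_equiv_cartpowP k0 (Tset0 s eta I q0) (Tset0 s1 eta' I' q0).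
have cases s1 a iota a0 := @scaled_Tset_cases F L K eps hepsK eps0 eps1 eps2
  s s1 a eta eta' I I' iota hs a0 heta heta0 heta' hI hI' dimI1.
have iota_eta0 (iota : {rmorphism L -> L}) : iota eta != 0.
  by rewrite fmorph_eq0.
case/andP: hs1 => s_gt0 s_lt; case/andP: hs'1 => _ s'_lt.
split.
- move=> ne_ss' ne_sts' eqIK /equivP[a [iota [a0 bij_iota eqT]]].
  have dim_eq d : (\dim I <= d)%N -> (d %| t)%N -> d = t.
    by rewrite eqIK => ? ?; apply/eqP; rewrite eqn_leq dvdn_leq.
  have [[_ _ _ prop] | [_ _ _ prop]] := cases s' a iota a0 eqT.
    have [d [le_d d_t]] := direct_exponents hI a0 heta'0 prop.
    by rewrite (dim_eq d) // !modn_small // => e; apply: ne_ss'.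
  have [d [le_d d_t]] :=
    reversed_exponents hI a0 (iota_eta0 iota) heta'0 prop.
  rewrite (dim_eq d) // => t_ss'.
  by apply: ne_sts'; apply: dvdn_add_small t_ss'; rewrite ?s_gt0.
- split.
    case/equivP=> a [iota [a0 bij_iota eqT]].
    have [[eps_fix Ka eqI' prop] | [_ _ _ prop]] := cases s a iota a0 eqT;
      last first.
      have [d [le_d d_t]] :=
        reversed_exponents hI a0 (iota_eta0 iota) heta'0 prop.
      move/(dvdn_double_leq2 hs d_t).
      by move/(leq_trans le_d); rewrite leqNgt hdim.
    have ratio : a ^+ (q ^ s - 1) = iota eta * eta'^-1.
      have Ip := memv_pick I.
      have ip0 : iota (vpick I) ^+ (q ^ s) != 0.
        rewrite expf_neq0 // fmorph_eq0 vpick0.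
        by apply: contraTneq dimI1 => ->; rewrite dimv0.
      have := prop _ Ip; rewrite exprMn mulrA => /(mulIf ip0) e.
      apply: (mulIf heta'0); apply: (mulfI a0); rewrite mulfVK // -e.
      by rewrite mulrA -exprS subn1 prednK ?expn_gt0 ?q0 // mulrC.
    exists iota; split=> //.
    + exact: Eset_image.
    + by rewrite -ratio relnorm_frob_ratio.
    + by exists a; split.
  case=> iota [bij_iota _ _ [Th [KTh eTh eqI']]].
  have Th0 : Th != 0.
    apply/eqP => e; move/eqP: eTh; rewrite e expr0n subn_eq0 leqNgt.
    rewrite -[X in (X < _)%N](expn0 q) ltn_exp2l // s_gt0 /= eq_sym.
    by rewrite mulf_eq0 invr_eq0 (negPf heta'0) (negPf (iota_eta0 iota)).
  apply: (equivP s).2; exists Th, iota; split=> //.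
  apply: (scaled_TsetE (f := fun z => Th * iota z)).
    by rewrite eqI' image_comp.
  move=> z Iz; rewrite rmorphD rmorphM rmorphXn /= mulrDr exprMn; congr (_ + _).
  have -> : Th ^+ (q ^ s) = Th * (iota eta * eta'^-1).
    by rewrite -eTh -exprS subn1 prednK // expn_gt0 q0.
  by move: (iota z ^+ _) (iota eta) => X b; field.
- have ts_gt0 : (0 < t - s)%N by rewrite subn_gt0.
  have frob_cancel (iota : {rmorphism L -> L}) z :
      z \in I -> (iota z ^+ (q ^ s)) ^+ (q ^ (t - s)) = iota z.
    move=> Iz; rewrite /q expr_frob subnKC ?(ltnW s_lt) // frobK //.
    by apply: rmorph_subfield; apply: (subvP hI).
  have expzE (x : L) n : x != 0 -> x ^ (1 - n%:Z) = x / x ^+ n.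
    by move=> x0; rewrite expfzDr // expr1z exprnN.
  split.
    case/equivP=> a [iota [a0 bij_iota eqT]].
    have [[_ _ _ prop] | [eps_inv Ea eqI' prop]] :=
      cases (t - s)%N a iota a0 eqT.
      have [d [le_d d_t e]] := direct_exponents hI a0 heta'0 prop.
      have : (d %| s + s)%N.
        (* Modulo d: s + s = (t - s) + s = t = 0. *)
        by rewrite /dvdn -modnDml -e modnDml subnK ?(ltnW s_lt).
      move/(dvdn_double_leq2 hs d_t).
      by move/(leq_trans le_d); rewrite leqNgt hdim.
    exists iota; split=> //.
      apply: Eset_image => //; apply: (mulIf eps0).
      by rewrite eps_inv -exprSr subn1 prednK ?(ltn_trans _ hl).
    exists a; split=> //; rewrite expzE //.
    have Ip := memv_pick I.
    have ip0 : iota (vpick I) != 0.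
      rewrite fmorph_eq0 vpick0.
      by apply: contraTneq dimI1 => ->; rewrite dimv0.
    have := prop _ Ip; rewrite !exprMn frob_cancel // !mulrA => /(mulIf ip0) e.
    by rewrite -[X in X / _]e mulrAC mulfK ?expf_neq0.
  case=> iota [bij_iota _ [La [ELa eLa eqI']]].
  (* The integer power of 0 with the nonzero exponent 1 - q^(t - s) is 0. *)
  have La0 : La != 0.
    apply/eqP => e; move/eqP: eLa; rewrite e exp0rz subr_eq0.
    have -> : (1 == (q ^ (t - s))%N%:Z) = false.
      apply/negbTE; rewrite eqz_nat ltn_eqF //.
      by rewrite -[X in (X < _)%N](expn0 q) ltn_exp2l.
    rewrite eq_sym mulf_eq0 expf_eq0 (negPf heta'0) (negPf (iota_eta0 iota)).
    by rewrite andbF.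
  apply: (equivP (t - s)%N).2; exists La, iota; split=> //.
  apply: (scaled_TsetE (f := fun z => La * iota eta * iota z ^+ (q ^ s))).
    by rewrite eqI' image_comp.
  (* The K-component of the scaled element comes from its second summand. *)
  move=> z Iz; rewrite rmorphD rmorphM rmorphXn /= mulrDr mulrA addrC.
  congr (_ + _); rewrite !exprMn frob_cancel // mulrA mulrCA -eLa expzE //.
  by rewrite [La / _]mulrC mulVKf ?expf_neq0.
Qed.
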